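(* Let $(P,\eta,H,M,F)$ be a constrained Hamiltonian system. Consider the constrained equation for vector fields $X\in\mathfrak{X}(P)$: $$\flat(X)-\mathrm{d}H+(H+\mathcal{R}(H))\,\eta\in F^{\circ},\qquad X_{|M}\in\mathfrak{X}(M).$$ The uniqueness of solutions of this equation is equivalent to the condition $${}^{\bot}F\cap TM=\{0\}.$$
   Context: A contact manifold $(P,\eta)$ of dimension $2n+1$ is a manifold with a $1$-form $\eta$ such that $\eta\wedge(\mathrm{d}\eta)^n$ is a volume form. The map $\flat:TP\to T^*P$, $\flat(v)=\iota_v\mathrm{d}\eta+\eta(v)\eta$, is a vector bundle isomorphism with inverse $\sharp$. The Reeb vector field $\mathcal{R}$ is determined by $\iota_{\mathcal{R}}\mathrm{d}\eta=0$, $\eta(\mathcal{R})=1$. A constrained Hamiltonian system $(P,\eta,H,M,F)$ consists of a contact manifold $(P,\eta)$, a Hamiltonian function $H:P\to\mathbb{R}$, an embedded submanifold $M\subseteq P$ and a regular distribution $F$ on $P$ along $M$, i.e. a vector subbundle of $T_MP$ (the tangent vectors to $P$ at points of $M$). $F^{\circ}\subseteq T_M^*P$ is the annihilator of $F$, and ${}^{\bot}F=\sharp(F^{\circ})$. Since $F$ is given only along $M$, membership in $F^{\circ}$ is a condition at the points of $M$, and solutions are compared along $M$.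
   Formalization: That ⊥F∩TM={0} implies uniqueness is proved as stated; the converse, false in general, is proved assuming that a solution exists and that ⊥F∩TM is a vector subbundle of T_MP (its rank may vary between components of M). *)

(* Defs.v *)
From HB Require Import structures.
From mathcomp Require Import all_boot all_order all_algebra all_fingroup.
From mathcomp Require Import all_classical all_reals all_analysis.
Import Order.TTheory GRing.Theory Num.Theory.
Import numFieldNormedType.Exports.

Set Implicit Arguments.
Unset Strict Implicit.
Unset Printing Implicit Defensive.

Local Open Scope classical_set_scope.
Local Open Scope ring_scope.

(* All manifolds are real, C^oo, Hausdorff and second
    countable. *)

Section SmoothMaps.
Variables (R : realType) (V W : normedModType R).

(* For finite-dimensional [V] and open [U], the derivative x |-> 'd f x is C^k
   on [U] iff all the directional derivatives 'D_v f are. *)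
Fixpoint Ck_on (k : nat) (U : set V) (f : V -> W) : Prop :=
  if k is k'.+1 then
    (forall x, U x -> differentiable f x) /\ (forall v, Ck_on k' U ('D_v f))
  else forall x, U x -> {for x, continuous f}.

Definition smooth_on (U : set V) (f : V -> W) : Prop :=
  forall k, Ck_on k U f.

End SmoothMaps.

Section Manifolds.
Variables (R : realType) (m : nat).

(* [chart_map] and [chart_inv] are total; their values outside [chart_dom] and
   its image are irrelevant. *)
Record chart (P : topologicalType) := Chart {
  chart_dom : set P;
  chart_map :> P -> 'rV[R]_m;
  chart_inv : 'rV[R]_m -> P;
  chart_dom_open : open chart_dom;
  chart_image_open : open (chart_map @` chart_dom);
  chart_mapK : forall p, chart_dom p -> chart_inv (chart_map p) = p;
  chart_map_continuous : forall p, chart_dom p -> {for p, continuous chart_map};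
  chart_inv_continuous : forall x, (chart_map @` chart_dom) x ->
    {for x, continuous chart_inv}
}.

Definition compatible (P : topologicalType) (c c' : chart P) : Prop :=
  smooth_on (c @` (chart_dom c `&` chart_dom c')) (c' \o chart_inv c) /\
  smooth_on (c' @` (chart_dom c `&` chart_dom c')) (c \o chart_inv c').

(* [chart_at p] is an arbitrary chart around [p]. It is only used to coordinatize
   the tangent space: a tangent vector at [p] is identified with its vector of
   components in the chart [chart_at p], so that T_pP is 'rV[R]_m. *)
Record manifold := Manifold {
  point_space :> topologicalType;
  manifold_hausdorff : hausdorff_space point_space;
  manifold_second_countable : @second_countable point_space;
  atlas : set (chart point_space);
  atlas_compatible : forall c c', atlas c -> atlas c' -> compatible c c';
  atlas_maximal : forall c, (forall c', atlas c' -> compatible c c') -> atlas c;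
  chart_at : point_space -> chart point_space;
  chart_at_atlas : forall p, atlas (chart_at p);
  chart_at_dom : forall p, chart_dom (chart_at p) p
}.

Variable P : manifold.

Definition smooth_function (H : P -> R) : Prop :=
  forall c, atlas c ->
    smooth_on (c @` chart_dom c) (H \o chart_inv c : 'rV[R]_m -> R^o).

(* Components in the chart [c] of the tangent vector [v] at [p]. *)
Definition tangent_coord (c : chart P) (p : P) (v : 'rV[R]_m) : 'rV[R]_m :=
  'D_v (c \o chart_inv (chart_at p)) (chart_at p p).

Definition vector_field := P -> 'rV[R]_m.

Definition smooth_field_on (U : set P) (X : vector_field) : Prop :=
  forall c, atlas c ->
    smooth_on (c @` (chart_dom c `&` U))
      (fun x => tangent_coord c (chart_inv c x) (X (chart_inv c x))).

(* Covectors are column vectors, paired with tangent vectors as follows. *)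
Definition pairing (v : 'rV[R]_m) (a : 'cV[R]_m) : R := (v *m a) ord0 ord0.

Definition one_form := P -> 'cV[R]_m.

(* Components of the 1-form [a] in the chart [c], as functions of the point [x]
   of the image of [c]; the derivative is the [j]-th coordinate vector of [c]
   expressed in the reference chart of the point. *)
Definition form_coord (c : chart P) (a : one_form) (x : 'rV[R]_m) : 'cV[R]_m :=
  let p := chart_inv c x in
  \col_j pairing ('D_(delta_mx ord0 j) (chart_at p \o chart_inv c) x) (a p).

Definition smooth_form (a : one_form) : Prop :=
  forall c, atlas c -> smooth_on (c @` chart_dom c) (form_coord c a).

Definition differential (H : P -> R) : one_form := fun p =>
  \col_j 'D_(delta_mx ord0 j)
    (H \o chart_inv (chart_at p) : 'rV[R]_m -> R^o) (chart_at p p).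

(* Matrix of the 2-form da at [p]: entry (i, j) is d_i a_j - d_j a_i. *)
Definition ext_diff (a : one_form) (p : P) : 'M[R]_m :=
  let c := chart_at p in
  \matrix_(i, j)
    ('D_(delta_mx ord0 i)
       (fun x => form_coord c a x j ord0 : R^o) (c p)
     - 'D_(delta_mx ord0 j)
       (fun x => form_coord c a x i ord0 : R^o) (c p)).

Definition contract (v : 'rV[R]_m) (w : 'M[R]_m) : 'cV[R]_m := (v *m w)^T.

Section Submanifolds.
Variables (d : nat) (M : set P).

Definition slice_chart (p : P) (c : chart P) : Prop :=
  [/\ atlas c, chart_dom c p &
    forall q, chart_dom c q ->
      (M q <-> forall j : 'I_m, (d <= j)%N -> c q ord0 j = c p ord0 j)].

(* [M] is an embedded submanifold of dimension [d]. *)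
Definition embedded_submanifold : Prop :=
  (d <= m)%N /\ forall p, M p -> exists c, slice_chart p c.

(* T_pM as a subset of T_pP, for [p] in [M]; the condition does not depend on the
   slice chart. *)
Definition tangent_space (p : P) : set 'rV[R]_m :=
  [set v | forall c, slice_chart p c ->
    forall j : 'I_m, (d <= j)%N -> tangent_coord c p v ord0 j = 0].

End Submanifolds.

(* Around [p], the family of subspaces D_q of T_qP, q in [M], has a smooth frame
   of [k] vector fields. Smoothness along [M] is that of local extensions to
   [P]. *)
Definition frame_near (M : set P) (D : P -> set 'rV[R]_m) (k : nat) (p : P) :
    Prop :=
  exists (U : set P) (E : P -> 'M[R]_(k, m)),
    [/\ open U, U p,
        (forall i, smooth_field_on U (fun q => row i (E q))) &
        forall q, (U `&` M) q ->
          row_free (E q) /\ D q = [set v | (v <= E q)%MS]].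

Definition regular_distribution (M : set P) (F : P -> set 'rV[R]_m) : Prop :=
  exists k, forall p, M p -> frame_near M F k p.

(* A vector subbundle of T_MP whose rank may depend on the connected component
   of [M]. *)
Definition vector_subbundle (M : set P) (D : P -> set 'rV[R]_m) : Prop :=
  forall p, M p -> exists k, frame_near M D k p.

Definition annihilator (F : P -> set 'rV[R]_m) (p : P) : set 'cV[R]_m :=
  [set a | forall v, F p v -> pairing v a = 0].

Variable eta : one_form.

Definition flat (p : P) (v : 'rV[R]_m) : 'cV[R]_m :=
  contract v (ext_diff eta p) + pairing v (eta p) *: eta p.

(* [flat p] is bijective when [eta] is a contact form. *)
Definition sharp (p : P) (a : 'cV[R]_m) : 'rV[R]_m :=
  xget 0 [set v | flat p v = a].

Definition reeb : vector_field := fun p =>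
  xget 0 [set r | contract r (ext_diff eta p) = 0 /\ pairing r (eta p) = 1].

Definition perp (F : P -> set 'rV[R]_m) (p : P) : set 'rV[R]_m :=
  sharp p @` annihilator F p.

Section System.
Variables (H : P -> R) (M : set P) (d : nat) (F : P -> set 'rV[R]_m).

Definition constrained_equation_lhs (X : vector_field) : one_form := fun p =>
  flat p (X p) - differential H p
  + (H p + pairing (reeb p) (differential H p)) *: eta p.

Definition is_solution (X : vector_field) : Prop :=
  [/\ smooth_field_on setT X,
      (forall p, M p -> annihilator F p (constrained_equation_lhs X p)) &
      (forall p, M p -> tangent_space d M p (X p))].

Definition has_solution : Prop := exists X, is_solution X.

Definition uniqueness_of_solutions : Prop :=
  forall X Y, is_solution X -> is_solution Y -> forall p, M p -> X p = Y p.

Definition perp_cap_tangent (p : P) : set 'rV[R]_m :=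
  perp F p `&` tangent_space d M p.

Definition perp_cap_tangent_trivial : Prop :=
  forall p, M p -> perp_cap_tangent p = [set 0].

End System.

End Manifolds.

Section Contact.
Variables (R : realType) (n : nat) (P : manifold R n.*2.+1) (eta : one_form P).

(* (eta /\ (d eta)^n)_p (v_0, ..., v_2n), with the normalization
   (a /\ b)(v) = 1/(k! l!) \sum_s sgn(s) (a (x) b)(v_s) for a k-form and an
   l-form. *)
Definition wedge_eta_deta (p : P) (v : 'I_n.*2.+1 -> 'rV[R]_n.*2.+1) : R :=
  2^-1 ^+ n *
  \sum_(s : 'S_n.*2.+1) (-1) ^+ s * pairing (v (s ord0)) (eta p) *
    \prod_(i < n) pairing (v (s (inord i.*2.+2)))
                    (contract (v (s (inord i.*2.+1))) (ext_diff eta p)).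

Definition contact_form : Prop :=
  smooth_form eta /\ forall p, exists v, wedge_eta_deta p v != 0.

Record constrained_hamiltonian_system (H : P -> R) (M : set P) (d : nat)
    (F : P -> set 'rV[R]_n.*2.+1) : Prop := {
  chs_contact : contact_form;
  chs_hamiltonian : smooth_function H;
  chs_submanifold : embedded_submanifold d M;
  chs_distribution : regular_distribution M F
}.

End Contact.

(* Main.v *)
Require Import Defs.
From HB Require Import structures.
From mathcomp Require Import all_boot all_order all_algebra all_fingroup.
From mathcomp Require Import all_classical all_reals all_analysis.
From mathcomp Require Import ring.
Import Order.TTheory GRing.Theory Num.Theory.
Import numFieldNormedType.Exports.

(** The constrained equation is affine in the field, and its linear part at a point
    is [flat eta p]. On a contact manifold [flat eta p] is bijective with inverse
    [sharp eta p] ([flatK], [sharpK]), so along [M] the difference of two solutions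
    takes its values in [perp_cap_tangent] ([is_solution_sub]), and conversely a
    solution remains one after the addition of a smooth field with values in
    [perp_cap_tangent] along [M] ([is_solution_add]).

    If [perp_cap_tangent] is trivial, this gives uniqueness at once. For the
    converse, a nonzero vector [u] of [perp_cap_tangent] at a point [p] of [M] must
    be turned into a global smooth field. A local frame of the subbundle gives a
    local section through [u], which is multiplied by a bump function supported in
    the domain of the frame and extended by zero ([subbundle_section_extension]).
    Adding it to a given solution yields a second one with a different value at
    [p].

    Two ingredients have to be built. The bijectivity of [flat] comes from the
    volume condition: a vector killed by [flat eta p] is killed by [eta] and by its
    exterior derivative, hence by the whole volume form ([contact_flat_eq0], through
    the multilinear expansion [pfaffian_sum_singular]). The bump functions come from
    [expR (- t^-1)], in a family of functions stable under derivation
    ([is_derive_exp_inv_poly]), and from the stability of [Ck_on] under sums,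
    products and composition. *)

Set Implicit Arguments.
Unset Strict Implicit.
Unset Printing Implicit Defensive.

Local Open Scope classical_set_scope.
Local Open Scope ring_scope.

(** * Functions of class C^k between normed spaces *)

Section CkFunctions.
Context {R : realType} {V W : normedModType R}.
Implicit Types (A B : set V) (f g : V -> W).

(** Differentiability is a property of the germ: a perturbation vanishing near the
    point does not change the first-order expansion there. *)
Lemma near_eq_differentiable f g (x : V) :
  (\near x, f x = g x) -> differentiable f x -> differentiable g x.
Proof.
move=> fg df; have [cf /eqaddoP ef] := (diff_locallyP x f).1 df.
have fgx : f x = g x by exact: nbhs_singleton fg.
have eg : g \o shift x = cst (g x) + 'd f x +o_ 0 id.
  have efg : \forall y \near 0, f (y + x) = g (y + x).
    have := fg; rewrite (near_shift 0 x) /=.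
    by apply: filterS => y /=; rewrite subr0.
  apply/eqaddoP => e e0; near=> y; rewrite /= !fctE /= -fgx -(near efg y)//.
  by near: y; exact: ef e e0.
apply/diff_locallyP; have dgE := diff_unique cf eg.
by split; rewrite dgE.
Unshelve. all: by end_near. Qed.

Lemma Ck_onS k A B f : A `<=` B -> Ck_on k B f -> Ck_on k A f.
Proof.
elim: k f => [|k IH] f AB /=; first by move=> cf x /AB/cf.
by case=> df Df; split=> [x /AB/df //|v]; exact: IH.
Qed.

(** [Ck_on] is a condition at each point separately, hence it glues: this is what
    reduces smoothness on a manifold to the members of a cover. *)
Lemma Ck_onU k A B f : Ck_on k A f -> Ck_on k B f -> Ck_on k (A `|` B) f.
Proof.
elim: k f => [|k IH] f /= => [cA cB x [/cA|/cB]//|[dA DA] [dB DB]].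
by split=> [x [/dA|/dB]|v]//; exact: IH.
Qed.

(** Openness matters here: the derivatives of [f] and [g] agree at a point only
    because [f] and [g] agree around it. *)
Lemma eq_Ck_on k A f g : open A -> (forall x, A x -> f x = g x) ->
  Ck_on k A f -> Ck_on k A g.
Proof.
move=> oA; have nA x : A x -> \near x, A x by move=> Ax; exact: open_nbhs_nbhs.
elim: k f g => [|k IH] f g fg /=.
  move=> cf x Ax; rewrite /prop_for /continuous_at -fg//.
  apply: cvg_trans (cf x Ax); apply: near_eq_cvg.
  by apply: filterS (nA x Ax) => y /fg.
have nfg x : A x -> \near x, f x = g x.
  by move=> Ax; apply: filterS (nA x Ax) => y /fg.
case=> df Df; split=> [x Ax|v].
  exact: near_eq_differentiable (nfg x Ax) (df x Ax).
by apply: IH (Df v) => x Ax; apply: near_eq_derive; exact: nfg.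
Qed.

Lemma Ck_onW k A f : Ck_on k.+1 A f -> Ck_on k A f.
Proof.
elim: k f => [|k IH] f [df Df]; last by split=> // v; exact: IH.
by move=> x /df; exact: differentiable_continuous.
Qed.

Lemma Ck_on_cst k A (w : W) : Ck_on k A (cst w).
Proof.
elim: k w => [|k IH] w /=; first by move=> x _; exact: cst_continuous.
split=> [x _|v]; first exact: differentiable_cst.
rewrite (_ : 'D_v (cst w) = cst 0) //.
by apply/funext => x; rewrite derive_cst.
Qed.

Lemma Ck_onD k A f g : open A ->
  Ck_on k A f -> Ck_on k A g -> Ck_on k A (f \+ g).
Proof.
move=> oA; elim: k f g => [|k IH] f g /=.
  by move=> cf cg x Ax; apply: continuousD; [exact: cf|exact: cg].
case=> df Df [dg Dg]; split=> [x Ax|v].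
  by apply: differentiableD; [exact: df|exact: dg].
apply: eq_Ck_on oA _ (IH _ _ (Df v) (Dg v)) => x Ax /=.
by rewrite deriveD//; apply: diff_derivable; [exact: df|exact: dg].
Qed.

Lemma Ck_on_sum k A (I : Type) (r : seq I) (F : I -> V -> W) : open A ->
  (forall i, Ck_on k A (F i)) -> Ck_on k A (fun x => \sum_(i <- r) F i x).
Proof.
move=> oA cF; elim: r => [|i r IH].
  by apply: eq_Ck_on oA _ (Ck_on_cst k A 0) => x _; rewrite big_nil.
apply: eq_Ck_on oA _ (Ck_onD oA (cF i) IH) => x _.
by rewrite big_cons.
Qed.

End CkFunctions.

Lemma Ck_on_id {R : realType} {V : normedModType R} k (A : set V) : Ck_on k A id.
Proof.
case: k => [|k] /=; first by move=> x _; exact: cvg_id.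
split=> [x _|v]; first exact: ex_diff.
rewrite (_ : 'D_v id = cst v); first exact: Ck_on_cst.
by apply/funext => x; rewrite derive_id.
Qed.

Section Scaling.
Context {R : realType} {V W : normedModType R}.
Implicit Types (A : set V) (b : V -> R) (f : V -> W).

Let scale_is_bilinear : bilinear_for
    (GRing.Scale.Law.clone _ _ *:%R _) (GRing.Scale.Law.clone _ _ *:%R _)
    (fun (a : R) (w : W) => a *: w).
Proof.
split=> [w|a] c x y /=; first by rewrite scalerDl scalerA.
by rewrite scalerDr !scalerA mulrC.
Qed.

(** Scaling is bilinear and jointly continuous, so its differential is the Leibniz
    expression, and the chain rule applies to the pair of the two factors. *)
Lemma is_diff_scale b f (x : V) : differentiable b x -> differentiable f x ->
  is_diff x (fun y => b y *: f y) (fun v => b x *: 'd f x v + 'd b x v *: f x).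
Proof.
move=> db df.
pose sM := bilinear_isBilinear.Build R R W W _ _ _ scale_is_bilinear.
pose s : {bilinear R -> W -> W} := HB.pack (fun (a : R) (w : W) => a *: w) sM.
have cs : continuous (fun p : R * W => s p.1 p.2).
  by move=> p; exact: scale_continuous.
have dp := differentiable_pair db df.
have ds := differentiable_bilin (b x, f x) cs.
apply: DiffDef; first exact: differentiable_comp dp ds.
rewrite (diff_comp dp ds); apply/funext => v /=.
by rewrite (diff_bilin _ cs) (diff_pair db df).
Qed.

(** Induction on the order: by the Leibniz rule a directional derivative of the
    product is a sum of two products of lower order. *)
Lemma Ck_on_scale k A b f : open A ->
  Ck_on k A b -> Ck_on k A f -> Ck_on k A (fun x => b x *: f x).
Proof.
move=> oA; elim: k b f => [|k IH] b f.
  by move=> cb cf x Ax; apply: cvgZ; [exact: cb|exact: cf].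
move=> cb cf; have [db Db] := cb; have [df Df] := cf.
have dbf x (Ax : A x) := is_diff_scale (db x Ax) (df x Ax).
split=> [x /dbf|v]; first by case.
apply: (@eq_Ck_on _ _ _ _ _ (fun x => b x *: 'D_v f x + 'D_v b x *: f x)) => //.
  move=> x Ax; rewrite !deriveE; [|by case: (dbf x Ax)|exact: db|exact: df].
  by have [_ ->] := dbf x Ax.
apply: Ck_onD => //; [exact: IH (Ck_onW cb) (Df v)|exact: IH (Db v) (Ck_onW cf)].
Qed.

End Scaling.

Section Composition.
Context {R : realType} {V W W' : normedModType R}.
Implicit Types (A : set V).

(** A continuous linear map commutes with directional derivatives. *)
Lemma Ck_on_linear k A (L : {linear W -> W'}) f : open A -> continuous L ->
  Ck_on k A f -> Ck_on k A (L \o f).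
Proof.
move=> oA cL; have dL w : differentiable L w by exact: linear_differentiable.
elim: k f => [|k IH] f /=.
  by move=> cf x Ax; apply: continuous_comp; [exact: cf|exact: cL].
case=> df Df; split=> [x /df dfx|v]; first exact: differentiable_comp.
apply: eq_Ck_on oA _ (IH _ (Df v)) => x /df dfx /=.
rewrite !deriveE//; last exact: differentiable_comp.
by rewrite (diff_comp dfx (dL _)) /= (diff_lin _ cL).
Qed.

End Composition.

Section Coord.
Context {R : realType} {V W : normedModType R} {m : nat}.
Implicit Types (A : set V).

Lemma Ck_on_coord k A (f : V -> 'rV[R]_m) j : open A ->
  Ck_on k A f -> Ck_on k A (fun x => f x ord0 j : R).
Proof.
move=> oA cf.
have lc : linear (fun w : 'rV[R]_m => w ord0 j : R) by move=> a u w; rewrite !mxE.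
pose cM := GRing.isLinear.Build _ _ _ _ _ lc.
pose c : {linear 'rV[R]_m -> R} := HB.pack (fun w : 'rV[R]_m => w ord0 j : R) cM.
by apply: (@Ck_on_linear _ _ _ _ k A c f oA _ cf); exact: coord_continuous.
Qed.

Lemma derive_row_sum (f : 'rV[R]_m -> W) (x v : 'rV[R]_m) :
  differentiable f x ->
  'D_v f x = \sum_j v ord0 j *: 'D_(delta_mx ord0 j) f x.
Proof.
move=> df; rewrite deriveE// {1}(row_sum_delta v) linear_sum.
by apply: eq_bigr => j _; rewrite linearZ deriveE.
Qed.

(** Induction on the order, for all [f] at once: a directional derivative of the
    composite is a combination of partial derivatives of [f] composed with [g],
    whose coefficients are the coordinates of a derivative of [g]. The
    intermediate space is a coordinate space so that these finitely many partial
    derivatives suffice. *)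
Lemma Ck_on_comp k A (B : set 'rV[R]_m) (g : V -> 'rV[R]_m)
    (f : 'rV[R]_m -> W) :
  open A -> (forall x, A x -> B (g x)) ->
  Ck_on k A g -> Ck_on k B f -> Ck_on k A (f \o g).
Proof.
move=> oA gAB; elim: k f g gAB => [|k IH] f g gAB cg cf.
  by move=> x Ax; apply: continuous_comp; [exact: cg|exact/cf/gAB].
have [dg Dg] := cg; have [df Df] := cf.
have dfg x : A x -> differentiable (f \o g) x.
  by move=> Ax; apply: differentiable_comp; [exact: dg|exact/df/gAB].
split=> // v.
apply: (@eq_Ck_on _ _ _ _ _ (fun x => \sum_j
  ('D_v g x) ord0 j *: ('D_(delta_mx ord0 j) f \o g) x)) => //.
  move=> x Ax; rewrite [RHS]deriveE; last exact: dfg.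
  rewrite diff_comp; [|exact: dg|exact/df/gAB].
  rewrite /= -!deriveE; [|exact: dg|exact/df/gAB].
  by rewrite -derive_row_sum//; exact/df/gAB.
apply: Ck_on_sum => // j; apply: Ck_on_scale => //.
  exact: Ck_on_coord (Dg v).
exact: IH gAB (Ck_onW cg) (Df _).
Qed.

End Coord.

(** * Smooth bump functions *)

Section Flat.
Context {R : realType}.
Implicit Types p : {poly R}.

(** The classical flat function is the case [p = 1]. The polynomial factor makes
    the family stable under derivation, so that its members are smooth by an
    induction on the order that never leaves the family. *)
Definition exp_inv_poly p (t : R) : R :=
  if 0 < t then p.[t^-1] * expR (- t^-1) else 0.

(** Termwise, since [s ^+ i <= i`! * expR s] for nonnegative [s]. *)
Lemma horner_le_expR p :
  exists2 C, 0 <= C & forall s, 0 <= s -> `|p.[s]| <= C * expR s.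
Proof.
exists (\sum_(i < size p) `|p`_i| * i`!%:R) => [|s s0].
  by apply: sumr_ge0 => i _; rewrite mulr_ge0.
rewrite horner_coef mulr_suml (le_trans (ler_norm_sum _ _ _))//.
apply: ler_sum => i _; rewrite normrM -mulrA ler_wpM2l// normrX ger0_norm//.
case: (nat_of_ord i) => [|k].
  by rewrite expr0 fact0 mul1r (le_trans _ (expR_ge1Dx s))// lerDl.
rewrite mulrC -ler_pdivrMr ?ltr0n ?fact_gt0//.
by apply: le_trans (expR_ge1Dxn k s0); rewrite lerDr.
Qed.

(** With [s = t^-1], this is the bound of [s ^+ 2 * p.[s]] by [expR s]. It gives
    both the continuity and the vanishing of the derivative at [0]. *)
Lemma exp_inv_poly_le_sqr p :
  exists2 C, 0 <= C & forall t, `|exp_inv_poly p t| <= C * t ^+ 2.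
Proof.
have [C C0 hC] := horner_le_expR ('X^2 * p); exists C => // t.
rewrite /exp_inv_poly; case: ltP => [t0|_]; last by rewrite normr0 mulr_ge0 ?sqr_ge0.
have t1 : 0 <= t^-1 by rewrite invr_ge0 ltW.
have := hC _ t1; rewrite hornerM hornerXn normrM normrX (ger0_norm t1).
rewrite normrM (ger0_norm (expR_ge0 _)) expRN exprVn.
rewrite mulrC ler_pdivrMr ?exprn_gt0// => h.
by rewrite ler_pdivrMr ?expR_gt0// mulrAC.
Qed.

(** The derivative of [p.[t^-1] * expR (- t^-1)] is
    [t^-1 ^+ 2 * (p.[t^-1] - p^`().[t^-1]) * expR (- t^-1)]. *)
Lemma is_derive_exp_inv_poly p (t : R) :
  is_derive t 1 (exp_inv_poly p) (exp_inv_poly ('X^2 * (p - p^`())) t).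
Proof.
have [t0|t0|->] := ltgtP t 0.
- apply: (@near_eq_is_derive R R R (cst 0)).
    near=> x; rewrite /exp_inv_poly ltNge ltW//.
    by near: x; exact: lt_nbhsl.
  by rewrite /exp_inv_poly ltNge (ltW t0) /=; exact: is_derive_cst.
- apply: (@near_eq_is_derive R R R (fun x => p.[x^-1] * expR (- x^-1))).
    near=> x; rewrite /exp_inv_poly ifT//.
    by near: x; exact: lt_nbhsr.
  have tn0 : t != 0 by rewrite gt_eqF.
  have dV : is_derive t 1 (@GRing.inv R) (- t ^- 2).
    apply: (is_derive_eq (is_deriveV (f := id) tn0 (is_derive_id t 1))).
    by rewrite /GRing.scale/= mulr1.
  have dp := is_derive1_comp (is_derive_poly p t^-1) dV.
  have de := is_derive1_comp (g := - @GRing.inv R)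
    (is_derive_expR (- t^-1)) (is_deriveN dV).
  apply: (is_derive_eq (is_deriveM dp de)).
  rewrite /exp_inv_poly t0 !hornerE /= /GRing.scale/= !fctE.
  by field.
- have [C C0 hC] := exp_inv_poly_le_sqr p.
  suff dl : h^-1 *: (exp_inv_poly p (h *: 1 + 0) - exp_inv_poly p 0)
      @[h --> 0^'] --> (0 : R).
    rewrite {2}/exp_inv_poly ltxx; apply: DeriveDef; first by apply/cvg_ex; exists 0.
    exact/cvg_lim.
  apply/cvgr0Pnorm_le => e e0; near=> h.
  have hn0 : h != 0 by near: h; exact: nbhs_dnbhs_neq.
  rewrite addr0 [X in _ - X]/exp_inv_poly ltxx subr0 /GRing.scale/= mulr1.
  rewrite normrM normfV ler_pdivrMl ?normr_gt0// (le_trans (hC h))//.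
  rewrite -[h ^+ 2]ger0_norm ?sqr_ge0// normrX expr2 mulrCA ler_wpM2l//.
  have : `|h| <= e / (C + 1).
    by near: h; apply: dnbhs0_le; rewrite divr_gt0// ltr_wpDl.
  rewrite ler_pdivlMr ?ltr_wpDl// mulrDr mulr1 mulrC; apply: le_trans.
  by rewrite lerDl.
Unshelve. all: by end_near. Qed.

Lemma Ck_on_exp_inv_poly (V : normedModType R) k p (A : set V) (q : V -> R) :
  open A -> Ck_on k A q -> Ck_on k A (exp_inv_poly p \o q).
Proof.
have dphi r t : differentiable (exp_inv_poly r) t.
  by apply/derivable1_diffP; have [] := is_derive_exp_inv_poly r t.
move=> oA; elim: k p => [|k IH] p.
  move=> cq x Ax; apply: continuous_comp; first exact: cq.
  exact: differentiable_continuous.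
move=> cq; have [dq Dq] := cq; split=> [x Ax|v].
  exact: differentiable_comp (dq x Ax) (dphi p _).
apply: (@eq_Ck_on _ _ _ _ _ (fun x =>
    'D_v q x *: (exp_inv_poly ('X^2 * (p - p^`())) \o q) x)) => //.
  move=> x Ax; rewrite [RHS]deriveE.
    rewrite (diff_comp (dq x Ax) (dphi p _)).
    rewrite /= -(deriveE v (dq x Ax)).
    rewrite deriv1E; last by have [] := is_derive_exp_inv_poly p (q x).
    by rewrite derive1E; have [_ ->] := is_derive_exp_inv_poly p (q x).
  exact: differentiable_comp (dq x Ax) (dphi p _).
exact: Ck_on_scale oA (Dq v) (IH _ (Ck_onW cq)).
Qed.

End Flat.

Section Bump.
Context {R : realType} {m : nat}.
Implicit Types x y : 'rV[R]_m.

(** The flat function composed with [r ^+ 2] minus the squared Euclidean distance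
    to [x]. The norm on row vectors is the sup norm, whose balls contain the
    Euclidean ones of the same radius. *)
Lemma smooth_bump x (r : R) : 0 < r ->
  exists b : 'rV[R]_m -> R,
    [/\ smooth_on setT b, b x != 0 & forall y, b y != 0 -> ball x r y].
Proof.
move=> r0; pose q y := r ^+ 2 - \sum_j (y - x) ord0 j ^+ 2.
exists (exp_inv_poly 1 \o q); split=> [k||y].
- apply: Ck_on_exp_inv_poly; first exact: openT.
  pose s j (y : 'rV[R]_m) : R := y ord0 j - x ord0 j.
  have cs j : Ck_on k setT (s j).
    apply: Ck_onD; [exact: openT| |exact: Ck_on_cst].
    apply: (@Ck_on_coord R _ m k setT id j); first exact: openT.
    exact: Ck_on_id.
  pose q' y := r ^+ 2 + (-1) *: \sum_j s j y *: s j y.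
  apply: (@eq_Ck_on _ _ _ _ _ q'); first exact: openT.
    move=> y _; rewrite /q' /q scaleN1r; congr (_ - _).
    by apply: eq_bigr => j _; rewrite !mxE expr2.
  apply: Ck_onD; [exact: openT|exact: Ck_on_cst|].
  apply: Ck_on_scale; [exact: openT|exact: Ck_on_cst|].
  apply: Ck_on_sum; first exact: openT.
  by move=> j; apply: Ck_on_scale; first exact: openT.
- rewrite /= /q big1; last by move=> j _; rewrite subrr mxE expr0n.
  rewrite subr0 /exp_inv_poly exprn_gt0// hornerC mul1r.
  by rewrite gt_eqF// expR_gt0.
- rewrite /= /exp_inv_poly; case: ifP => [+ _|]; last by rewrite eqxx.
  rewrite subr_gt0 => lr.
  rewrite -ball_normE /= {1}/Num.norm /= mx_normrE.
  apply/bigmax_ltP; split=> // -[i j] _ /=.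
  rewrite ord1 -(ltr_pXn2r (n := 2)) ?nnegrE ?normr_ge0 ?(ltW r0)//.
  apply: le_lt_trans lr; rewrite real_normK ?num_real//.
  rewrite (bigD1 j)//= !mxE -sqrrN opprB lerDl.
  by apply: sumr_ge0 => l _; exact: sqr_ge0.
Qed.

End Bump.

(** * Vector fields on manifolds *)

Section ManifoldLemmas.
Context {R : realType} {m : nat} {P : manifold R m}.
Implicit Types (c : chart R m P) (U : set P) (X Y : vector_field P).

Lemma chart_image_openI c U : open U -> open (c @` (chart_dom c `&` U)).
Proof.
move=> oU; rewrite openE => _ [p [cp Up] <-].
have imp : (c @` chart_dom c) (c p) by exists p.
have n1 : nbhs (c p) (c @` chart_dom c).
  by apply: open_nbhs_nbhs; split=> //; exact: chart_image_open.
have n2 : nbhs (c p) (chart_inv c @^-1` U).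
  apply: (chart_inv_continuous imp).
  by rewrite chart_mapK//; exact: open_nbhs_nbhs.
apply: filterS2 n1 n2 => _ [q cq <-] /=; rewrite chart_mapK// => Uq.
by exists q.
Qed.

Lemma differentiable_transition c c' p : atlas c -> atlas c' ->
  chart_dom c p -> chart_dom c' p ->
  differentiable (c' \o chart_inv c) (c p).
Proof.
move=> ac ac' cp c'p; have [/(_ 1) /= [+ _] _] := atlas_compatible ac ac'.
by apply; exists p.
Qed.

(** The components in [c] are obtained from the reference components by the
    differential of the transition map, which exists because charts of the atlas
    are compatible. *)
Lemma tangent_coord_linear c p : atlas c -> chart_dom c p ->
  linear (tangent_coord c p).
Proof.
move=> ac cp a u v; rewrite /tangent_coord.
have dt := differentiable_transition (chart_at_atlas p) ac (chart_at_dom p) cp.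
by rewrite !(deriveE _ dt) linearP.
Qed.

Lemma tangent_coord0 c p : tangent_coord c p 0 = 0.
Proof. by rewrite /tangent_coord derive0. Qed.

Lemma smooth_field_onD U X Y : open U -> smooth_field_on U X ->
  smooth_field_on U Y -> smooth_field_on U (fun p => X p + Y p).
Proof.
move=> oU sX sY c ac k.
have oA := chart_image_openI (c := c) oU.
apply: eq_Ck_on oA _ (Ck_onD oA (sX c ac k) (sY c ac k)) => _ [p [cp Up] <-].
by rewrite /= chart_mapK// -[X p]scale1r (tangent_coord_linear ac cp) !scale1r.
Qed.

Lemma tangent_space_linear d (M : set P) p a (u v : 'rV[R]_m) :
  tangent_space d M p u -> tangent_space d M p v ->
  tangent_space d M p (a *: u + v).
Proof.
move=> Tu Tv c sc j dj; have [ac cp _] := sc.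
by rewrite (tangent_coord_linear ac cp) !mxE (Tu c sc) // (Tv c sc)// mulr0 addr0.
Qed.

Lemma tangent_space0 d (M : set P) p : tangent_space d M p 0.
Proof. by move=> c _ j _; rewrite tangent_coord0 mxE. Qed.

(** For a closed [K] inside an open [U], a function vanishing off [K] has only to
    be examined in the two open images of this cover, and it is zero on the
    second one. *)
Lemma closed_support_cover (c : chart R m P) (K U : set P) : K `<=` U ->
  c @` chart_dom c `<=`
    c @` (chart_dom c `&` U) `|` c @` (chart_dom c `&` ~` K).
Proof.
move=> KU _ [q cq <-]; have [/KU Uq|nKq] := pselect (K q).
  by left; exists q.
by right; exists q.
Qed.

(** Transport of a bump function of the coordinate space by a chart around [p].
    Its support [K] is the preimage of a closed ball, hence compact, and therefore
    closed in the whole manifold because the manifold is Hausdorff; without this,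
    the extension by zero could fail to be smooth at boundary points of the chart
    domain. *)
Lemma smooth_bump_manifold U p : open U -> U p ->
  exists (K : set P) (b : P -> R),
    [/\ closed K, K `<=` U, (forall q, ~ K q -> b q = 0), b p != 0 &
      smooth_function b].
Proof.
move=> oU Up; pose c0 := chart_at p.
have ac0 : atlas c0 := chart_at_atlas p.
have c0p : chart_dom c0 p := chart_at_dom p.
pose V := U `&` chart_dom c0.
have oV : open V by apply: openI => //; exact: chart_dom_open.
have /open_nbhs_nbhs/nbhs_closedballP [r rU] :
    open_nbhs (c0 p) (c0 @` (chart_dom c0 `&` U)).
  by split; [exact: chart_image_openI|exists p].
pose B := closed_ball (c0 p) r%:num.
have BV x : B x -> (c0 @` chart_dom c0) x /\ V (chart_inv c0 x).
  by move=> /rU [q [cq Uq] <-]; rewrite chart_mapK//; split=> //; exists q.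
pose K := chart_inv c0 @` B.
have cB : compact B.
  apply: bounded_closed_compact; last exact: closed_ball_closed.
  exists (`|c0 p| + r%:num); split; first exact: num_real.
  move=> M rM x; rewrite /B closed_ballE// /closed_ball_ /= => xr.
  rewrite (le_trans _ (ltW rM))// -[x](subrK (c0 p)).
  by rewrite addrC (le_trans (ler_normD _ _))// lerD2l distrC.
have cK : closed K.
  apply: compact_closed; first exact: manifold_hausdorff.
  apply: continuous_compact => //; apply: continuous_in_subspaceT => x.
  by rewrite inE => /BV [/chart_inv_continuous].
have KV : K `<=` V by move=> _ [x /BV [_ ?] <-].
have [b [sb bp bB]] := smooth_bump (c0 p) (gt0 r).
pose f q := if q \in V then b (c0 q) else 0.
have fK q : ~ K q -> f q = 0.
  rewrite /f; case: ifPn => // /set_mem [Uq cq] nKq.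
  apply/eqP/negPn/negP => /bB bq; apply: nKq.
  by exists (c0 q); [exact: subset_closed_ball|exact: chart_mapK].
exists K, f; split=> //; first by move=> q /KV[].
  by rewrite /f mem_set.
move=> c ac k; apply: Ck_onS (closed_support_cover (c := c) KV) _.
have oA := chart_image_openI (c := c) oV.
have oB := chart_image_openI (c := c) (closed_openC cK).
apply: Ck_onU.
  apply: (@eq_Ck_on _ _ _ _ _ (b \o (c0 \o chart_inv c))) => //.
    by move=> _ [q [cq Vq] <-]; rewrite /= /f chart_mapK// mem_set.
  apply: (@Ck_on_comp _ _ _ _ _ _ setT) => //.
  have [_ /(_ k)] := atlas_compatible ac0 ac; apply: Ck_onS.
  by move=> _ [q [cq [_ c0q]] <-]; exists q.
apply: eq_Ck_on oB _ (Ck_on_cst k _ 0) => _ [q [cq nKq] <-].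
by rewrite /= chart_mapK// fK.
Qed.

(** A local field with constant coefficients [w] in a smooth frame becomes a global
    smooth field after multiplication by a bump function supported in the domain
    of the frame. *)
Lemma smooth_field_extension k U p (E : P -> 'M[R]_(k, m)) (w : 'rV[R]_k) :
  open U -> U p -> (forall i, smooth_field_on U (fun q => row i (E q))) ->
  exists (b : P -> R), [/\ b p != 0, (forall q, ~ U q -> b q = 0) & 
    smooth_field_on setT (fun q => b q *: (w *m E q))].
Proof.
move=> oU Up sE.
have [K [b [cK KU bK bp sb]]] := smooth_bump_manifold oU Up.
exists b; split=> // [q nUq|c ac l]; first by apply: bK => /KU.
have oA := chart_image_openI (c := c) oU.
have oB := chart_image_openI (c := c) (closed_openC cK).
apply: (@Ck_onS _ _ _ _ _
  (c @` (chart_dom c `&` U) `|` c @` (chart_dom c `&` ~` K))).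
  by rewrite setIT; exact: closed_support_cover.
apply: Ck_onU.
  pose f x := \sum_i w ord0 i *:
    tangent_coord c (chart_inv c x) (row i (E (chart_inv c x))).
  apply: (@eq_Ck_on _ _ _ _ _ (fun x => (b \o chart_inv c) x *: f x)) => //.
    move=> _ [q [cq Uq] <-]; rewrite /= /f chart_mapK//.
    pose tM := GRing.isLinear.Build _ _ _ _ _ (tangent_coord_linear ac cq).
    pose t : {linear 'rV[R]_m -> 'rV[R]_m} := HB.pack (tangent_coord c q) tM.
    rewrite -[tangent_coord c q]/(t : _ -> _) linearZ; congr (_ *: _).
    rewrite mulmx_sum_row linear_sum; apply: eq_bigr => i _.
    by rewrite linearZ.
  apply: Ck_on_scale => //.
    by apply: Ck_onS (sb c ac l) => _ [q [cq _] <-]; exists q.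
  apply: Ck_on_sum => // i; apply: Ck_on_scale => //; first exact: Ck_on_cst.
  exact: sE.
apply: eq_Ck_on oB _ (Ck_on_cst l _ 0) => _ [q [cq nKq] <-].
by rewrite chart_mapK// bK// scale0r tangent_coord0.
Qed.

End ManifoldLemmas.

(** * Alternating sums of products of pairings *)

Section Alternating.
Context {K : comNzRingType} {n : nat}.
Local Notation m := n.*2.+1.

Lemma prod_ord_pairs (F : 'I_m -> K) :
  \prod_k F k = F ord0 * \prod_(i < n) (F (inord i.*2.+1) * F (inord i.*2.+2)).
Proof.
pose G k := F (inord k).
have -> : \prod_k F k = \prod_(k < m) G k.
  by apply: eq_bigr => k _; rewrite /G inord_val.
have -> : F ord0 = G 0%N by rewrite -[ord0]inord_val.
rewrite -[RHS]/(G 0%N * \prod_(i < n) (G i.*2.+1 * G i.*2.+2)).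
move: G => {F} G.
elim: n G => [|l IH] G; first by rewrite big_ord_recr !big_ord0 /= mul1r mulr1.
rewrite doubleS big_ord_recr big_ord_recr /= IH big_ord_recr /=.
by rewrite !mulrA.
Qed.

(** The alternating sum defining the top form of [a] and [W], evaluated at the rows
    of [A], is multilinear and alternating in those rows, so it is a multiple of
    [\det A]. Concretely, expanding every pairing in coordinates makes it a
    combination of determinants of matrices whose columns are columns of [A]. *)
Lemma pfaffian_sum_singular (a : 'cV[K]_m) (W A : 'M[K]_m) :
  \det A = 0 ->
  \sum_(s : 'S_m) (-1) ^+ s * (row (s ord0) A *m a) ord0 ord0 *
    \prod_(i < n) (row (s (inord i.*2.+2)) A *m
                   (row (s (inord i.*2.+1)) A *m W)^T) ord0 ord0 = 0.
Proof.
move=> dA.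
(* [h j g] assembles the column indices chosen in the expansion: [j] in the slot
   of [a], and the pair [g i] in the two slots of the [i]-th factor. *)
pose h (j : 'I_m) (g : {ffun 'I_n -> 'I_m * 'I_m}) (k : 'I_m) : 'I_m :=
  if val k is k'.+1 then
    if insub k'./2 is Some i then if odd k' then (g i).1 else (g i).2 else j
  else j.
have h0 j g : h j g ord0 = j by [].
have hodd j g (i : 'I_n) : h j g (inord i.*2.+1) = (g i).2.
  rewrite /h /= inordK ?ltnS ?ltn_double// doubleK odd_double.
  by rewrite insubT //= => ?; congr (g _).2; exact: val_inj.
have heven j g (i : 'I_n) : h j g (inord i.*2.+2) = (g i).1.
  rewrite /h /= inordK ?ltnS ?ltn_Sdouble// /= uphalf_double odd_double.
  by rewrite insubT //= => ?; congr (g _).1; exact: val_inj.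
pose D j g := \det (colsub (h j g) A).
have D0 j g : D j g = 0.
  by rewrite /D -[A]mulmx1 -mulmx_colsub det_mulmx dA mul0r.
transitivity (\sum_j \sum_(g : {ffun 'I_n -> 'I_m * 'I_m})
    (a j ord0 * \prod_i W (g i).2 (g i).1) * D j g); last first.
  by rewrite big1 // => j _; rewrite big1 // => g _; rewrite D0 mulr0.
have DE j g : D j g = \sum_(s : 'S_m) (-1) ^+ s * \prod_k A (s k) (h j g k).
  rewrite /D -det_tr; apply: eq_bigr => s _; congr (_ * _).
  by apply: eq_bigr => k _; rewrite !mxE.
transitivity (\sum_(s : 'S_m) \sum_j \sum_(g : {ffun 'I_n -> 'I_m * 'I_m})
    (a j ord0 * \prod_i W (g i).2 (g i).1) *
    ((-1) ^+ s * \prod_k A (s k) (h j g k))); last first.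
  rewrite exchange_big; apply: eq_bigr => j _.
  rewrite exchange_big; apply: eq_bigr => g _.
  by rewrite DE mulr_sumr.
apply: eq_bigr => s _.
rewrite mxE -mulrA mulr_suml mulr_sumr; apply: eq_bigr => j _.
transitivity ((-1) ^+ s * (A (s ord0) j * a j ord0 * \prod_(i < n)
   \sum_(t : 'I_m * 'I_m) (A (s (inord i.*2.+2)) t.1 *
     (A (s (inord i.*2.+1)) t.2 * W t.2 t.1)))).
  congr (_ * (_ * _)); first by rewrite mxE.
  apply: eq_bigr => i _.
  rewrite mxE -(pair_bigA _ (fun x y => A (s (inord i.*2.+2)) x *
     (A (s (inord i.*2.+1)) y * W y x))) /=; apply: eq_bigr => x _.
  by rewrite !mxE mulr_sumr; apply: eq_bigr => y _; rewrite !mxE.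
rewrite bigA_distr_bigA /= !mulr_sumr; apply: eq_bigr => g _.
rewrite prod_ord_pairs h0.
have -> : \prod_(i < n) (A (s (inord i.*2.+1)) (h j g (inord i.*2.+1)) *
     A (s (inord i.*2.+2)) (h j g (inord i.*2.+2))) =
   \prod_(i < n) (A (s (inord i.*2.+1)) (g i).2 *
     A (s (inord i.*2.+2)) (g i).1).
  by apply: eq_bigr => i _; rewrite hodd heven.
have rearrange (e x y q r w : K) :
    e * (x * y * (q * (r * w))) = y * w * (e * (x * (r * q))) by ring.
by rewrite !big_split /= rearrange.
Qed.

End Alternating.

(** * Invertibility of the flat map of a contact form *)

Section ContactAlgebra.
Context {R : realType} {n : nat} {P : manifold R n.*2.+1} (eta : one_form P).
Local Notation m := n.*2.+1.
Local Notation D := (ext_diff eta).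

Definition flat_mx (p : P) : 'M[R]_m := D p + eta p *m (eta p)^T.

Lemma flatE p v : flat eta p v = (v *m flat_mx p)^T.
Proof.
rewrite /flat /flat_mx mulmxDr linearD /=; congr (_ + _).
rewrite mulmxA [v *m _]mx11_scalar mul_scalar_mx linearZ /= trmxK.
by rewrite /pairing.
Qed.

Lemma flat_linear p : linear (flat eta p).
Proof. by move=> a u v; rewrite !flatE mulmxDl -scalemxAl linearP. Qed.

Lemma ext_diff_skew p : (D p)^T = - D p.
Proof. by apply/matrixP => i j; rewrite !mxE opprB. Qed.

(** Pairing [flat eta p v] with [v] kills the skew part and leaves the square of
    [v *m eta p]. *)
Lemma flat_eq0_kernel p v : flat eta p v = 0 -> v *m D p = 0 /\ v *m eta p = 0.
Proof.
move=> fv0.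
have Dvv : (v *m (v *m D p)^T) ord0 ord0 = 0.
  apply/eqP; rewrite -eqNr; apply/eqP.
  rewrite -[in RHS](trmxK (v *m _)) [in RHS]mxE [in RHS]trmx_mul trmxK -mulmxA.
  by rewrite [in LHS]trmx_mul ext_diff_skew mulNmx mulmxN mxE opprK.
have ve : (v *m eta p) ord0 ord0 = 0.
  have := congr1 (fun a => (v *m a) ord0 ord0) fv0.
  rewrite /flat /Defs.contract /pairing mulmxDr -scalemxAr mulmx0 mxE Dvv !mxE.
  by rewrite add0r -expr2 => /eqP; rewrite sqrf_eq0 => /eqP.
have e0 : v *m eta p = 0 by rewrite [LHS]mx11_scalar ve raddf0.
split=> //; move: fv0; rewrite /flat /pairing ve scale0r addr0 => /(congr1 trmx).
by rewrite /Defs.contract trmxK linear0.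
Qed.

(** If [v] were a nonzero vector killed by both [eta] and its exterior derivative,
    both forms would be invariant under the projection [pi] along [v]; the volume
    form would then be unchanged when its arguments are projected to a proper
    subspace, where it vanishes. *)
Lemma contact_flat_eq0 p v : contact_form eta -> flat eta p v = 0 -> v = 0.
Proof.
move=> [_ /(_ p) [u wu]] /flat_eq0_kernel [vD ve]; apply/eqP; apply: contraNT wu => v0.
have [f vf] : exists f : 'cV[R]_m, v *m f = 1%:M.
  have /rV0Pn [j vj] := v0; exists ((v ord0 j)^-1 *: delta_mx j ord0).
  rewrite -scalemxAr -colE [col j v]mx11_scalar mxE scale_scalar_mx.
  by rewrite mulVf.
pose pi := 1%:M - f *m v.
have piD : pi *m D p = D p by rewrite mulmxBl mul1mx -mulmxA vD mulmx0 subr0.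
have piDT : pi *m (D p)^T = (D p)^T by rewrite ext_diff_skew mulmxN piD.
have pie : pi *m eta p = eta p by rewrite mulmxBl mul1mx -mulmxA ve mulmx0 subr0.
have dpi : \det pi = 0.
  apply/eqP/det0P; exists v => //.
  by rewrite mulmxBr mulmx1 mulmxA vf mul1mx subrr.
pose A : 'M[R]_m := \matrix_i u i.
have dA : \det (A *m pi) = 0 by rewrite det_mulmx dpi mulr0.
have := pfaffian_sum_singular (eta p) (D p) dA.
rewrite /wedge_eta_deta => S0; apply/eqP; rewrite -[RHS](mulr0 (2^-1 ^+ n)).
congr (_ * _); rewrite -[RHS]S0; apply: eq_bigr => s _.
rewrite /pairing /Defs.contract.
have rA k : row k (A *m pi) = u k *m pi by rewrite row_mul rowK.
rewrite rA -mulmxA pie; congr (_ * _ * _); apply: eq_bigr => i _.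
by rewrite !rA -(mulmxA _ pi (D p)) piD -mulmxA trmx_mul (mulmxA pi) piDT.
Qed.

Lemma flat_mx_unit p : contact_form eta -> flat_mx p \in unitmx.
Proof.
move=> ceta; rewrite -row_free_unit -kermx_eq0; apply/eqP/row_matrixP => i.
rewrite row0; apply: (@contact_flat_eq0 p) => //.
by rewrite flatE -row_mul mulmx_ker row0 linear0.
Qed.

Lemma flatK p : contact_form eta -> cancel (flat eta p) (sharp eta p).
Proof.
move=> ce v; rewrite /sharp; case: xgetP => [w _ /= fw|/(_ v) []//].
apply/subr0_eq/(@contact_flat_eq0 p) => //.
by rewrite flatE mulmxBl linearB /= -!flatE fw subrr.
Qed.

Lemma sharpK p : contact_form eta -> cancel (sharp eta p) (flat eta p).
Proof.
move=> ce a; rewrite /sharp; case: xgetP => [w _ //|].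
move=> /(_ (a^T *m invmx (flat_mx p))); case.
by rewrite /= flatE mulmxKV ?trmxK// flat_mx_unit.
Qed.

Lemma perp0 (F : P -> set 'rV[R]_m) p : contact_form eta -> perp eta F p 0.
Proof.
move=> ce; exists 0; first by move=> v _; rewrite /pairing mulmx0 mxE.
by have := flatK p ce 0; rewrite flatE mul0mx trmx0.
Qed.

End ContactAlgebra.

(** * Solutions of the constrained equation *)

Section Solutions.
Context {R : realType} {n : nat} {P : manifold R n.*2.+1}
  (eta : one_form P) (H : P -> R) (M : set P) (d : nat)
  (F : P -> set 'rV[R]_n.*2.+1).

Lemma annihilator_linear p c (a a' : 'cV[R]_n.*2.+1) :
  annihilator F p a -> annihilator F p a' -> annihilator F p (c *: a + a').
Proof.
move=> Fa Fa' v Fv.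
have -> : pairing v (c *: a + a') = c * pairing v a + pairing v a'.
  by rewrite /pairing mulmxDr -scalemxAr mxE [X in X + _]mxE.
by rewrite Fa// Fa'// mulr0 addr0.
Qed.

(** The constrained equation is affine in the field with linear part [flat]: this
    is why differences of solutions are sections of [perp_cap_tangent]. *)
Lemma constrained_equation_lhs_shift X p (v : 'rV[R]_n.*2.+1) Y :
  Y p = X p + v ->
  constrained_equation_lhs eta H Y p =
  constrained_equation_lhs eta H X p + flat eta p v.
Proof.
rewrite /constrained_equation_lhs => ->.
rewrite -[X p]scale1r (flat_linear eta p) !scale1r.
by rewrite (addrAC (flat eta p (X p))) [LHS]addrAC.
Qed.

Lemma is_solution_sub X Y p : contact_form eta -> is_solution eta H M d F X ->
  is_solution eta H M d F Y -> M p ->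
  perp_cap_tangent eta M d F p (Y p - X p).
Proof.
move=> ce [_ FX TX] [_ FY TY] Mp; split; last first.
  rewrite addrC -scaleN1r.
  by apply: tangent_space_linear; [exact: TX|exact: TY].
exists (flat eta p (Y p - X p)); last exact: flatK.
have lhsYE := constrained_equation_lhs_shift (esym (subrKC (X p) (Y p))).
have <- : constrained_equation_lhs eta H Y p -
    constrained_equation_lhs eta H X p = flat eta p (Y p - X p).
  by rewrite lhsYE addrC addKr.
rewrite addrC -scaleN1r; apply: annihilator_linear; [exact: FX|exact: FY].
Qed.

Lemma is_solution_add X Z : contact_form eta -> is_solution eta H M d F X ->
  smooth_field_on setT Z ->
  (forall p, M p -> perp_cap_tangent eta M d F p (Z p)) ->
  is_solution eta H M d F (fun p => X p + Z p).
Proof.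
move=> ce [sX FX TX] sZ MZ; split=> [|p Mp|p Mp].
- by apply: smooth_field_onD => //; exact: openT.
- have [[a Fa aZ] _] := MZ p Mp.
  rewrite (@constrained_equation_lhs_shift X p (Z p))// -aZ sharpK//.
  rewrite -[X in annihilator _ _ (X + _)]scale1r.
  by apply: annihilator_linear => //; exact: FX.
- have [_ TZ] := MZ p Mp; rewrite -[X p]scale1r.
  by apply: tangent_space_linear => //; exact: TX.
Qed.

(** Every vector in the fibre of a subbundle is, up to a nonzero factor (the value
    of a bump function), the value of a global smooth field whose restriction to
    [M] is a section. Off the domain of the frame the section is zero, whence the
    hypothesis on [0]. *)
Lemma subbundle_section_extension (Q : P -> set 'rV[R]_n.*2.+1) p u :
  vector_subbundle M Q -> (forall q, M q -> Q q 0) -> M p -> Q p u ->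
  exists Z, [/\ smooth_field_on setT Z, (forall q, M q -> Q q (Z q)) &
    exists2 a, a != 0 & Z p = a *: u].
Proof.
move=> /(_ p) + Q0 Mp Qu => /(_ Mp) [k [U [E [oU Up sE QE]]]].
have [_ QpE] := QE p (conj Up Mp).
have [w uE] : exists w, u = w *m E p by move: Qu; rewrite QpE => /submxP.
have [b [bp bU sb]] := smooth_field_extension w oU Up sE.
exists (fun q => b q *: (w *m E q)); split=> // [q Mq|].
  have [Uq|/bU ->] := pselect (U q); last by rewrite scale0r; exact: Q0.
  by have [_ ->] := QE q (conj Uq Mq); rewrite /= scalemx_sub ?submxMl.
by exists (b p); rewrite ?uE.
Qed.

End Solutions.

Theorem proposition2 (R : realType) (n : nat) (P : manifold R n.*2.+1)
    (eta : one_form P) (H : P -> R) (M : set P) (d : nat)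
    (F : P -> set 'rV[R]_n.*2.+1) :
  constrained_hamiltonian_system eta H M d F ->
  (perp_cap_tangent_trivial eta M d F -> uniqueness_of_solutions eta H M d F) /\
  (has_solution eta H M d F -> vector_subbundle M (perp_cap_tangent eta M d F) ->
    (uniqueness_of_solutions eta H M d F <-> perp_cap_tangent_trivial eta M d F)).
Proof.
move=> [ce _ _ _].
have perp_tangent0 p : M p -> perp_cap_tangent eta M d F p 0.
  by move=> _; split; [exact: perp0|exact: tangent_space0].
have trivial_unique : perp_cap_tangent_trivial eta M d F ->
    uniqueness_of_solutions eta H M d F.
  move=> triv X Y solX solY p Mp; apply/esym/subr0_eq.
  by have := is_solution_sub ce solX solY Mp; rewrite triv.
split=> // -[X solX] vsb; split=> // uniq p Mp.
apply/seteqP; split=> [u Qu|_ ->]; last exact: perp_tangent0.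
have [Z [sZ MZ [a a0 Zp]]] := subbundle_section_extension vsb perp_tangent0 Mp Qu.
have := uniq _ _ (is_solution_add ce solX sZ MZ) solX p Mp.
rewrite /= Zp => /eqP.
by rewrite -subr_eq0 addrC addKr scaler_eq0 (negPf a0) => /eqP.
Qed.
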